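(* The minimum distance of a linear code $\mathcal{C}$ is not determined solely by the graded Betti numbers of the Orlik-Terao algebra of $\mathcal{C}$. That is, there exist a field $\mathbb{K}$ and linear codes $\mathcal{C}_1,\mathcal{C}_2$ over $\mathbb{K}$, each with pairwise nonproportional linear forms, whose Orlik-Terao algebras $\mathrm{OT}(\mathcal{C}_1)$ and $\mathrm{OT}(\mathcal{C}_2)$ have the same graded Betti numbers but whose minimum distances are different.
   Context: An $[n,k,d]$-linear code $\mathcal{C}$ over a field $\mathbb{K}$ is the image of an injective linear map $\mathbb{K}^k\to\mathbb{K}^n$, $\mathbf{x}\mapsto \mathbf{x}G$, where $G=(a_{ij})$ is a $k\times n$ matrix of rank $k\ge1$; the minimum distance $d$ is the smallest number of nonzero entries in a nonzero element of $\mathcal{C}$. Its linear forms are $\ell_j=\sum_{i=1}^k a_{ij}x_i\in\mathbb{K}[x_1,\ldots,x_k]$, $1\le j\le n$; pairwise nonproportional means $\gcd(\ell_i,\ell_j)=1$ for $i\ne j$, with all $\ell_i\ne0$. Orlik-Terao algebra: let $S=\mathbb{K}[y_1,\ldots,y_n]$ (standard grading) and let $\phi:S\to\mathbb{K}[1/\ell_1,\ldots,1/\ell_n]$ be the ring epimorphism $\phi(y_i)=1/\ell_i$. Then $\mathrm{OT}(\mathcal{C})=S/\ker(\phi)$. Its graded Betti numbers are those of its minimal graded free resolution as a graded $S$-module. *)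

(* Defs.v *)
From HB Require Import structures.
From mathcomp Require Import all_boot all_order all_algebra.
From mathcomp Require Export mpoly.

Set Implicit Arguments.
Unset Strict Implicit.
Unset Printing Implicit Defensive.

Import GRing.Theory.
Local Open Scope ring_scope.
Local Open Scope quotient_scope.

Section Codes.
Variables (K : fieldType) (n k : nat).
Implicit Types (G : 'M[K]_(k, n)).

Definition codeword G (c : 'rV[K]_n) : Prop := exists x : 'rV[K]_k, c = x *m G.

Definition hamming_weight (c : 'rV[K]_n) : nat := #|[set j | c 0 j != 0]|.

Definition minimum_distance G (d : nat) : Prop :=
  (exists c, [/\ codeword G c, c != 0 & hamming_weight c = d]) /\
  (forall c, codeword G c -> c != 0 -> (d <= hamming_weight c)%N).

(* A code is given by a generator matrix, which the linear forms depend on. *)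
Definition linear_code G (d : nat) : Prop :=
  [/\ (0 < k)%N, \rank G = k & minimum_distance G d].

Definition linear_form G (j : 'I_n) : {mpoly K[k]} :=
  \sum_(i < k) G i j *: 'X_i.

Definition mpoly_divides (p q : {mpoly K[k]}) : Prop := exists r, q = r * p.

(* gcd(p, q) = 1 *)
Definition mpoly_coprime (p q : {mpoly K[k]}) : Prop :=
  forall r, mpoly_divides r p -> mpoly_divides r q -> r \is a GRing.unit.

Definition pairwise_nonproportional G : Prop :=
  (forall j, linear_form G j != 0) /\
  (forall i j, i != j -> mpoly_coprime (linear_form G i) (linear_form G j)).

(* The map y_j |-> 1 / l_j, with codomain enlarged from K[1/l_1, ..., 1/l_n]
   to the field of rational functions; this does not affect its kernel. *)
Definition ot_phi G : {mpoly K[n]} -> {fraction {mpoly K[k]}} :=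
  mmap (@tofrac {mpoly K[k]} \o @mpolyC k K)
       (fun j => (tofrac (linear_form G j))^-1).

HB.instance Definition _ G := GRing.RMorphism.copy (ot_phi G)
  (mmap (@tofrac {mpoly K[k]} \o @mpolyC k K)
        (fun j => (tofrac (linear_form G j))^-1)).

Definition ot_ideal G : {pred {mpoly K[n]}} := [pred p | ot_phi G p == 0].

Lemma ot_ideal_closed G : idealr_closed (ot_ideal G).
Proof.
split=> [||a u v]; rewrite !inE; first by rewrite raddf0.
  by rewrite rmorph1 oner_eq0.
by move=> /eqP u0 /eqP v0; rewrite rmorphD rmorphM /= u0 v0 mulr0 addr0.
Qed.

HB.instance Definition _ G := isIdealr.Build _ (ot_ideal G) (ot_ideal_closed G).

Definition OT G := {ideal_quot (ot_ideal G)}.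
HB.instance Definition _ G := GRing.ComNzRing.on (OT G).

(* p in S acts on OT(C) as multiplication by ot_proj G p. *)
Definition ot_proj G (p : {mpoly K[n]}) : OT G := \pi_{ideal_quot (ot_ideal G)} p.

Definition ot_homog G (d : nat) (a : OT G) : Prop :=
  exists2 p : {mpoly K[n]}, p \is d.-homog & a = ot_proj G p.

End Codes.

Section Resolutions.
Variables (K : fieldType) (n : nat).

(* F_i = (+)_a S(- gf_deg a), with elements written as row vectors, so that
   F_{i+1} -> F_i is v |-> v *m gf_diff i.  As OT(C) is generated in degree 0,
   its minimal resolution has no twist by a negative degree. *)
Record graded_free_seq := GradedFreeSeq {
  gf_rank : nat -> nat;
  gf_deg  : forall i, 'I_(gf_rank i) -> nat;
  gf_diff : forall i, 'M[{mpoly K[n]}]_(gf_rank i.+1, gf_rank i)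
}.

Implicit Types (F : graded_free_seq).

Definition degree_preserving F : Prop :=
  forall i a b m, m \in msupp (gf_diff F i a b) ->
    (mdeg m + gf_deg b)%N = gf_deg a.

Definition minimal F : Prop :=
  forall i a b, (gf_diff F i a b)@_0%MM = 0.

Section Augmented.
Variables (k : nat) (G : 'M[K]_(k, n)).

Definition augmentation F (e : 'I_(gf_rank F 0) -> OT G)
    (v : 'rV[{mpoly K[n]}]_(gf_rank F 0)) : OT G :=
  \sum_a ot_proj G (v 0 a) * e a.

Definition graded_free_resolution F : Prop :=
  degree_preserving F /\
  exists e : 'I_(gf_rank F 0) -> OT G,
  [/\ forall a, ot_homog (gf_deg a) (e a),
      forall x, exists v, augmentation e v = x,
      forall v, augmentation e v = 0 <-> exists w, v = w *m gf_diff F 0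
    & forall i (v : 'rV_(gf_rank F i.+1)),
        v *m gf_diff F i = 0 <-> exists w, v = w *m gf_diff F i.+1].

Definition minimal_graded_free_resolution F : Prop :=
  graded_free_resolution F /\ minimal F.

End Augmented.

Definition betti F (i j : nat) : nat := #|[set a : 'I_(gf_rank F i) | gf_deg a == j]|.

(* beta i j is the number of copies of S(-j) in homological degree i of the
   minimal graded free resolution of OT(C), unique up to isomorphism. *)
Definition graded_betti_numbers (k : nat) (G : 'M[K]_(k, n))
    (beta : nat -> nat -> nat) : Prop :=
  exists2 F, minimal_graded_free_resolution G F &
    forall i j, beta i j = betti F i j.

End Resolutions.

Definition same_graded_betti_numbers (K : fieldType) (n1 k1 n2 k2 : nat)
    (G1 : 'M[K]_(k1, n1)) (G2 : 'M[K]_(k2, n2)) : Prop :=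
  exists beta, graded_betti_numbers G1 beta /\ graded_betti_numbers G2 beta.

(* Main.v *)
Require Import Defs.
From mathcomp Require Import all_boot all_order all_algebra.
From mathcomp Require Import ring.

(** Adjoining a new variable to a code as one more linear form changes the
    minimum distance to 1, but only tensors the Orlik-Terao algebra with a
    polynomial ring in one variable, which leaves the graded Betti numbers as
    they are. The smallest instance of this is enough: the forms
    x_0, x_1, x_0 + x_1 have minimum distance 2, and the forms
    x_0, x_1, x_2, x_0 + x_1 have minimum distance 1. The two codes have
    different lengths and dimensions.

    Both are members of the family x_0, ..., x_(m+1), x_0 + x_1. Writing
    y_0, y_1, y_k for the generators 1 / x_0, 1 / x_1, 1 / (x_0 + x_1), there is
    the relation f = y_0 y_1 - y_k (y_0 + y_1), and the point is that it
    generates the whole ideal of relations ([ot_phi_eq0]). If p is a relation,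
    then some (y_0 + y_1)^N p is congruent modulo f to a polynomial without y_k
    ([eliminate_last_variable]). That polynomial is again a relation, now among
    1 / x_0, ..., 1 / x_(m+1), so it vanishes because these are algebraically
    independent ([inverse_variables_independent]). Hence f divides
    (y_0 + y_1)^N p, and the powers of y_0 + y_1 can be cancelled because
    y_0 + y_1 is not a zero divisor modulo f ([quadric_regular]).

    As f is a nonzero quadric, 0 -> S(-2) -> S -> 0 is the minimal resolution
    for every m ([quadric_resolution_minimal]), so the Betti numbers do not
    depend on m. *)

Set Implicit Arguments.
Unset Strict Implicit.
Unset Printing Implicit Defensive.

Import GRing.Theory.
Local Open Scope ring_scope.

Local Notation widen := (widen_ord (leqnSn _)).

(** * Two identities in a field *)

Lemma expr_subn_inv (F : fieldType) (x : F) d e :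
  x != 0 -> (d <= e)%N -> x ^+ (e - d) = x ^+ e * x^-1 ^+ d.
Proof.
by move=> x0 de; rewrite -{2}(subnK de) exprD exprVn mulfK // expf_neq0.
Qed.

Lemma inv_add_relation (F : fieldType) (x y : F) :
  x != 0 -> y != 0 -> x + y != 0 -> x^-1 * y^-1 - (x + y)^-1 * (x^-1 + y^-1) = 0.
Proof. by move=> x0 y0 xy0; field; apply/and3P; split. Qed.

(** * Polynomials in several variables *)

Section Polynomials.
Variables (K : fieldType) (n : nat).
Implicit Types (p q r : {mpoly K[n]}).

(** Saves handling monomials in the three inductions on polynomials below,
    each of which is about a set closed under the ring operations. *)
Lemma mpoly_ring_ind (P : {mpoly K[n]} -> Prop) :
  (forall c, P c%:MP) -> (forall i, P 'X_i) ->
  (forall p q, P p -> P q -> P (p + q)) ->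
  (forall p q, P p -> P q -> P (p * q)) ->
  forall p, P p.
Proof.
move=> PC PX PD PM; apply: mpolyind => [|c m p _ _ Pp].
  by rewrite -mpolyC0; apply: PC.
apply: (PD) => //; rewrite -mul_mpolyC; apply: (PM) => //.
rewrite mpolyXE_id; apply: (big_ind P) => [|//|i _]; first exact: PC.
elim: (m i) => [|e IHe]; first by rewrite expr0; apply: PC.
by rewrite exprS; apply: PM.
Qed.

Lemma mpoly_rmorph_eq (A : nzRingType) (f g : {rmorphism {mpoly K[n]} -> A}) :
  (forall c, f c%:MP = g c%:MP) -> (forall i, f 'X_i = g 'X_i) -> f =1 g.
Proof.
move=> fgC fgX; apply: mpoly_ring_ind => // p q fgp fgq.
  by rewrite !rmorphD fgp fgq.
by rewrite !rmorphM fgp fgq.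
Qed.

(** A linear form is irreducible, because degrees add in products: a common
    divisor of two linear forms that is not constant is proportional to
    both. *)
Lemma mpoly_coprime_linear p q :
  p \is 1.-homog -> q \is 1.-homog -> p != 0 -> q != 0 ->
  (forall a b : K, a *: p = b *: q -> a = 0) -> mpoly_coprime p q.
Proof.
move=> p1 q1 p0 q0 npq r [s ps] [t qt].
have size2 (u : {mpoly K[n]}) : u \is 1.-homog -> u != 0 -> msize u = 2%N.
  by move=> /dhomogP hu u0; rewrite -mlead_deg // hu ?mlead_supp.
have [s0 r0] : s != 0 /\ r != 0 by move: p0; rewrite ps mulf_eq0 => /norP[].
have t0 : t != 0 by move: q0; rewrite qt mulf_eq0 => /norP[].
have szs := size2 _ p1 p0; rewrite ps msizeM // in szs.
have szt := size2 _ q1 q0; rewrite qt msizeM // in szt.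
case: (ltnP 1 (msize r)) => szr; last first.
  have /msize_poly1P[c c0 ->] : msize r == 1%N.
    by rewrite eqn_leq szr lt0n msize_poly_eq0.
  by apply/unitrP; exists c^-1%:MP; rewrite -!mpolyCM mulVf ?mulfV.
have size1 (u : {mpoly K[n]}) :
    u != 0 -> (msize u + msize r).-1 = 2%N -> msize u == 1%N.
  rewrite -msize_poly_eq0; move: szr.
  by case: (msize u) (msize r) => [|[|a]] [|[|b]] //=; rewrite !addSn !addnS.
have /msize_poly1P[a a0 sa] := size1 s s0 szs.
have /msize_poly1P[b b0 tb] := size1 t t0 szt.
have b00 : b = 0.
  apply: (npq b a).
  by rewrite ps qt sa tb -!mul_mpolyC !mulrA -!mpolyCM [b * a]mulrC.
by rewrite b00 eqxx in b0.
Qed.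

(** Multiplying a relation among the inverses of the variables by a high power
    of their product reverses exponents, m |-> D - m, so it becomes a
    polynomial relation with the same coefficients. *)
Lemma inverse_variables_independent p :
  mmap (@tofrac {mpoly K[n]} \o @mpolyC n K)
    (fun i => (tofrac ('X_i : {mpoly K[n]}))^-1) p = 0 -> p = 0.
Proof.
move=> p0; pose D := msize p.
pose rev (m : 'X_{1..n}) := [multinom (D - m i)%N | i < n].
have leD m : m \in msupp p -> forall i, (m i <= D)%N.
  move=> /msize_mdeg_lt/ltnW mD i; apply: leq_trans mD.
  by rewrite mdegE (bigD1 i) //= leq_addr.
have rev_inj : {in msupp p &, injective rev}.
  move=> m m' /leD hm /leD hm' /mnmP rmm'; apply/mnmP => i.
  by have := rmm' i; rewrite !mnmE => e; rewrite -(subKn (hm i)) e subKn.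
have rev0 : \sum_(m <- msupp p) p@_m *: 'X_[rev m] = 0 :> {mpoly K[n]}.
  apply/eqP; rewrite -tofrac_eq0.
  suff -> : tofrac (\sum_(m <- msupp p) p@_m *: 'X_[rev m]) =
      (\prod_(i < n) tofrac ('X_i : {mpoly K[n]}) ^+ D) *
      mmap (@tofrac {mpoly K[n]} \o @mpolyC n K)
        (fun i => (tofrac ('X_i : {mpoly K[n]}))^-1) p.
    by rewrite p0 mulr0.
  rewrite rmorph_sum /mmap mulr_sumr big_seq [RHS]big_seq; apply: eq_bigr => m mp /=.
  rewrite -mul_mpolyC rmorphM /= mulrCA; congr (_ * _).
  rewrite mpolyXE_id rmorph_prod; rewrite -big_split /=; apply: eq_bigr => i _ /=.
  have X0 : tofrac ('X_i : {mpoly K[n]}) != 0.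
    by rewrite tofrac_eq0 -msupp_eq0 msuppX.
  rewrite rmorphXn /= mnmE; move: (tofrac _) X0 => x x0.
  by apply: expr_subn_inv => //; apply: leD.
apply/mpolyP => m; rewrite mcoeff0.
have [mp|/memN_msupp_eq0 //] := boolP (m \in msupp p).
have := congr1 (mcoeff (rev m)) rev0.
rewrite mcoeff0 raddf_sum /= (bigD1_seq m) //= mcoeffZ mcoeffX eqxx mulr1.
rewrite big_seq_cond big1 ?addr0 // => m' /andP[m'p m'm].
rewrite mcoeffZ mcoeffX (_ : _ == _ = false) ?mulr0 //.
by apply: contra_neqF m'm => /eqP /rev_inj ->.
Qed.

(** The remainder of p on division by 'X_i + 'X_j is p at 'X_j = - 'X_i. *)
Lemma mpoly_subst_opp_var (i j : 'I_n) : i != j ->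
  exists s : {rmorphism {mpoly K[n]} -> {mpoly K[n]}},
  [/\ s 'X_j = - 'X_i, forall l, l != j -> s 'X_l = 'X_l
    & forall p, exists q, p = s p + q * ('X_i + 'X_j)].
Proof.
move=> ij.
pose h l : {mpoly K[n]} := if l == j then - 'X_i else 'X_l.
pose s : {rmorphism {mpoly K[n]} -> {mpoly K[n]}} :=
  GRing.RMorphism.clone _ _ (mmap (@mpolyC n K) h) _.
have sX l : s 'X_l = h l by rewrite /s /= mmapX mmap1U.
exists s; split=> [|l lj|]; first by rewrite sX /h eqxx.
  by rewrite sX /h (negbTE lj).
apply: mpoly_ring_ind => [c|l|p q [p' pE] [q' qE]|p q [p' pE] [q' qE]].
- by exists 0; rewrite /s /= mmapC mul0r addr0.
- rewrite sX /h; case: eqP => [->|_]; first by exists 1; ring.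
  by exists 0; rewrite mul0r addr0.
- exists (p' + q'); rewrite rmorphD; move: pE qE.
  by move: (s p) (s q) => sp sq -> ->; ring.
- exists (p' * s q + p * q'); rewrite rmorphM; move: pE qE.
  by move: (s p) (s q) => sp sq -> ->; ring.
Qed.

End Polynomials.

(** * The codes and their linear forms *)

Section Family.
Variables (K : fieldType) (m : nat).

Let k := m.+2.
Let n := m.+3.
Let i0 : 'I_k := ord0.
Let i1 : 'I_k := lift ord0 ord0.

(** A triangle x_0, x_1, x_0 + x_1 of dependent forms together with m forms
    independent of it; the sum is put last so that removing it from the
    generators y_j leaves the image of [mwiden]. *)
Definition triangle_code : 'M[K]_(m.+2, m.+3) :=
  \matrix_(i, j) (((i : nat) == j) || (((j : nat) == m.+2) && (i < 2)%N))%:R.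

Local Notation G := triangle_code.

Lemma ord_max_or_widen (j : 'I_n) : j = ord_max \/ exists i : 'I_k, j = widen i.
Proof.
have [jk|jk] := ltnP j k; last first.
  by left; apply/val_inj/eqP; rewrite /= eqn_leq jk -ltnS ltn_ord.
by right; exists (Ordinal jk); apply: val_inj.
Qed.

Lemma triangle_code_widen i i' : G i (widen i') = (i == i')%:R.
Proof. by rewrite mxE /= (ltn_eqF (ltn_ord i')) orbF. Qed.

Lemma triangle_code_max i : G i ord_max = (i < 2)%:R.
Proof. by rewrite mxE /= (ltn_eqF (ltn_ord i)) eqxx. Qed.

Lemma linear_form_widen i : linear_form G (widen i) = 'X_i.
Proof.
rewrite /linear_form (bigD1 i) //= triangle_code_widen eqxx scale1r.
by rewrite big1 ?addr0 // => j /negbTE ji; rewrite triangle_code_widen ji scale0r.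
Qed.

Lemma linear_form_max : linear_form G ord_max = 'X_i0 + 'X_i1.
Proof.
rewrite /linear_form !big_ord_recl /= !triangle_code_max /= !scale1r.
by rewrite big1 ?addr0 // => j _; rewrite triangle_code_max scale0r.
Qed.

Lemma linear_form_coef (H : 'M[K]_(k, n)) i j : (linear_form H j)@_U_(i) = H i j.
Proof.
rewrite /linear_form raddf_sum /= (bigD1 i) //= mcoeffZ mcoeffXU eqxx mulr1.
by rewrite big1 ?addr0 // => l /negbTE li; rewrite mcoeffZ mcoeffXU li mulr0.
Qed.

Lemma linear_form_homog (H : 'M[K]_(k, n)) j : linear_form H j \is 1.-homog.
Proof.
by apply: rpred_sum => i _; apply: rpredZ; rewrite dhomogX /= mdeg1.
Qed.

Lemma linear_form_neq0 j : linear_form G j != 0.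
Proof.
apply/eqP => /(congr1 (mcoeff U_(if j == ord_max then i0 else inord j))).
rewrite linear_form_coef mcoeff0.
have [->|[i ->]] := ord_max_or_widen j.
  by rewrite eqxx triangle_code_max; apply/eqP/oner_neq0.
rewrite (_ : widen i == ord_max = false); last first.
  by rewrite -val_eqE /= ltn_eqF.
rewrite triangle_code_widen (_ : inord _ = i) ?eqxx; last first.
  by apply: val_inj; rewrite /= inordK.
exact/eqP/oner_neq0.
Qed.

Lemma triangle_code_nonproportional : pairwise_nonproportional G.
Proof.
split=> [j|i j ij]; first exact: linear_form_neq0.
apply: mpoly_coprime_linear; rewrite ?linear_form_homog ?linear_form_neq0 //.
move=> a b /mpolyP eab.
have {}eab l : a * G l i = b * G l j.
  by have := eab U_(l)%MM; rewrite !mcoeffZ !linear_form_coef.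
(* x_i is not proportional to x_0 + x_1: compare the coefficients of the one
   of x_0 and x_1 that is not x_i. *)
have other (l : 'I_k) : exists2 l' : 'I_k, (l' < 2)%N & l' != l.
  by case: (eqVneq i0 l) => [<-|]; [exists i1 | exists i0].
have [ei|[i' ei]] := ord_max_or_widen i; have [ej|[j' ej]] := ord_max_or_widen j; subst.
- by rewrite eqxx in ij.
- have [l l2 /negbTE lj] := other j'; have := eab l.
  by rewrite triangle_code_max triangle_code_widen l2 lj mulr1 mulr0.
- have [l l2 /negbTE li] := other i'; have := eab l.
  rewrite triangle_code_max triangle_code_widen l2 li mulr1 mulr0 => b0.
  by have := eab i'; rewrite triangle_code_widen eqxx -b0 mul0r mulr1.
- have := eab i'; rewrite !triangle_code_widen eqxx mulr1 => ->.
  by rewrite (_ : i' == j' = false) ?mulr0 //; apply: contra_neqF ij => /eqP ->.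
Qed.

Lemma triangle_code_rank : \rank G = k.
Proof.
apply/eqP; rewrite -/(row_free G); apply/row_freeP.
exists (\matrix_(j, i) ((j : nat) == i)%:R); apply/matrixP => i i'.
rewrite !mxE big_ord_recr /= triangle_code_max.
rewrite [X in _ * X]mxE /= (gtn_eqF (ltn_ord i')) mulr0 addr0.
rewrite (bigD1 i') //= triangle_code_widen mxE /= eqxx mulr1.
rewrite big1 ?addr0 // => j /negbTE ji.
by rewrite mxE /= (_ : (j : nat) == i' = false) ?mulr0.
Qed.

Lemma codeword_widen (x : 'rV[K]_k) i : (x *m G) 0 (widen i) = x 0 i.
Proof.
rewrite mxE (bigD1 i) //= triangle_code_widen eqxx mulr1.
by rewrite big1 ?addr0 // => j /negbTE ji; rewrite triangle_code_widen ji mulr0.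
Qed.

Lemma codeword_max (x : 'rV[K]_k) : (x *m G) 0 ord_max = x 0 i0 + x 0 i1.
Proof.
rewrite mxE !big_ord_recl /= !triangle_code_max /= !mulr1.
by rewrite big1 ?addr0 // => j _; rewrite triangle_code_max mulr0.
Qed.

Lemma hamming_weight_codeword (x : 'rV[K]_k) :
  hamming_weight (x *m G) =
  (\sum_i (x 0 i != 0)%R + (x 0 i0 + x 0 i1 != 0)%R)%N.
Proof.
rewrite /hamming_weight cardsE -sum1_card big_mkcond big_ord_recr /=.
congr addn; last by rewrite -codeword_max unfold_in; case: ifP.
by apply: eq_bigr => i _; rewrite -codeword_widen unfold_in; case: ifP.
Qed.

(** * The ideal of relations is principal *)

Local Notation S := {mpoly K[n]}.
Let y0 : S := 'X_(widen i0).
Let y1 : S := 'X_(widen i1).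
Let yk : S := 'X_ord_max.

(** The relation y_k^-1 = y_0^-1 + y_1^-1 with denominators cleared. *)
Definition triangle_quadric : {mpoly K[m.+3]} := y0 * y1 - yk * (y0 + y1).

Local Notation f := triangle_quadric.

Lemma triangle_quadric_neq0 : f != 0.
Proof.
(* The monomial y0 y1 does not cancel, as the other two involve yk. *)
suff: f@_(U_(widen i0) + U_(widen i1))%MM != 0.
  by apply: contra_neq => ->; rewrite mcoeff0.
rewrite /f mulrDr -!mpolyXD mcoeffB mcoeffD !mcoeffX eqxx.
have max_notin i : (U_(ord_max) + U_(i) == U_(widen i0) + U_(widen i1))%MM = false.
  by apply/negbTE/eqP => /mnmP/(_ ord_max); rewrite !mnmE eqxx.
by rewrite !max_notin addr0 subr0 oner_neq0.
Qed.

Lemma triangle_quadric_homog : f \is 2.-homog.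
Proof.
by rewrite /f; apply: rpredB; [|rewrite mulrDr; apply: rpredD];
   rewrite -mpolyXD dhomogX /= mdegD !mdeg1.
Qed.

Lemma ot_phi_quadric : ot_phi G f = 0.
Proof.
rewrite /f rmorphB !rmorphM rmorphD /=.
rewrite /ot_phi !mmapX !mmap1U !linear_form_widen linear_form_max rmorphD /=.
by apply: inv_add_relation; rewrite -?rmorphD tofrac_eq0 -?linear_form_max
  -?[mpolyX _ _]linear_form_widen linear_form_neq0.
Qed.

(** On polynomials that do not involve the last variable, [ot_phi] substitutes
    the inverses of the variables, and these are independent. *)
Lemma ot_phi_mwiden q : ot_phi G (mwiden q) = 0 -> q = 0.
Proof.
move=> hq; apply: inverse_variables_independent; rewrite -hq.
apply/esym; move: q {hq}.
apply: (@mpoly_rmorph_eq _ _ _ (ot_phi G \o @mwiden k K)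
  (mmap (@tofrac {mpoly K[k]} \o @mpolyC k K)
        (fun i => (tofrac ('X_i : {mpoly K[k]}))^-1))) => [c|i] /=.
  by rewrite mwidenC /ot_phi !mmapC.
by rewrite mwidenX mnmwiden1 /ot_phi !mmapX !mmap1U linear_form_widen.
Qed.

(** Modulo the quadric, (y0 + y1) yk is y0 y1, so that yk can be eliminated
    once y0 + y1 is inverted. *)
Lemma eliminate_last_variable (p : S) :
  exists N q h, (y0 + y1) ^+ N * p = mwiden q + h * f.
Proof.
have y0E : y0 = mwiden 'X_i0 by rewrite mwidenX mnmwiden1.
have y1E : y1 = mwiden 'X_i1 by rewrite mwidenX mnmwiden1.
move: p; apply: mpoly_ring_ind.
- by move=> c; exists 0, c%:MP, 0; rewrite expr0 mul1r mwidenC mul0r addr0.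
- move=> i; have [->|[i' ->]] := ord_max_or_widen i.
    exists 1%N, ('X_i0 * 'X_i1), (-1).
    by rewrite rmorphM /= -y0E -y1E /f -/yk; ring.
  by exists 0, 'X_i', 0; rewrite mwidenX mnmwiden1 expr0 mul1r mul0r addr0.
- move=> p p' [N [q [h e]]] [N' [q' [h' e']]].
  exists (N + N')%N, (('X_i0 + 'X_i1) ^+ N' * q + ('X_i0 + 'X_i1) ^+ N * q'),
    ((y0 + y1) ^+ N' * h + (y0 + y1) ^+ N * h').
  rewrite rmorphD !rmorphM !rmorphXn !rmorphD /= -y0E -y1E exprD.
  transitivity ((y0 + y1) ^+ N' * ((y0 + y1) ^+ N * p)
    + (y0 + y1) ^+ N * ((y0 + y1) ^+ N' * p')); first by ring.
  by rewrite e e'; ring.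
- move=> p p' [N [q [h e]]] [N' [q' [h' e']]].
  exists (N + N')%N, (q * q'), (mwiden q * h' + h * mwiden q' + h * h' * f).
  by rewrite exprD mulrACA e e' rmorphM /=; ring.
Qed.

Lemma sum_variables_neq0 : y0 + y1 != 0.
Proof.
apply/eqP => /(congr1 (mcoeff U_(widen i0))).
by rewrite mcoeffD !mcoeffXU eqxx mcoeff0 addr0; apply/eqP/oner_neq0.
Qed.

(** At y1 = - y0 the quadric becomes - y0^2, which is not a zero divisor. So
    (y0 + y1) p = q f forces q to vanish there, which means that y0 + y1
    divides q and can be cancelled. *)
Lemma quadric_regular (p : S) :
  (exists q, (y0 + y1) * p = q * f) -> exists q, p = q * f.
Proof.
move=> [q e].
have i01 : widen i0 != widen i1 :> 'I_n by [].
have [s [s1 sX /(_ q)[r qE]]] := mpoly_subst_opp_var K i01.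
have s0 : s y0 = y0 by apply: sX.
have sk : s yk = yk by apply: sX; rewrite -val_eqE.
have sq0 : s q = 0.
  have := congr1 s e; rewrite !rmorphM rmorphB !rmorphM !rmorphD /= s1 s0 sk.
  rewrite subrr mul0r mulr0 subr0 => /esym/eqP.
  have y0_neq0 : y0 != 0 by rewrite -msupp_eq0 msuppX.
  by rewrite !mulrN oppr_eq0 !mulf_eq0 !(negbTE y0_neq0) !orbF => /eqP.
exists r; apply: (@mulfI _ (y0 + y1)).
  exact: sum_variables_neq0.
have {}qE : q = r * (y0 + y1) by rewrite qE sq0 add0r.
by rewrite e qE; ring.
Qed.

Lemma ot_phi_eq0 (p : S) : ot_phi G p = 0 <-> exists q, p = q * f.
Proof.
split=> [p0|[q ->]]; last by rewrite rmorphM /= ot_phi_quadric mulr0.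
have [N [q [h e]]] := eliminate_last_variable p.
have q0 : q = 0.
  apply: ot_phi_mwiden; have := congr1 (ot_phi G) e.
  by rewrite rmorphD !rmorphM /= p0 ot_phi_quadric !mulr0 addr0.
rewrite q0 rmorph0 add0r in e.
elim: N h e => [|N IHN] h e; first by exists h; rewrite -e expr0 mul1r.
have [h' e'] : exists h', (y0 + y1) ^+ N * p = h' * f.
  by apply: quadric_regular; exists h; rewrite mulrA -exprS.
exact: IHN e'.
Qed.

(** * The resolution *)

(** The complex 0 -> S(-2) -> S -> 0 given by the quadric. The degrees and
    matrix entries are given by one formula also where the rank is 0. *)
Definition quadric_resolution : graded_free_seq K n :=
  @GradedFreeSeq K n (fun i => (i < 2)%N : nat) (fun i _ => i.*2)
    (fun i => const_mx f).

Lemma ot_proj_eq0 (p : S) : ot_proj G p = 0 <-> exists q, p = q * f.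
Proof.
rewrite -ot_phi_eq0.
have -> : (0 : OT G) = ot_proj G 0 by rewrite /ot_proj rmorph0.
have e : (ot_phi G p == 0) = (ot_proj G p == ot_proj G 0).
  by rewrite -[p in LHS]subr0; apply: (Quotient.idealrBE (ot_ideal G)).
by split=> /eqP; [rewrite -e | rewrite e] => /eqP.
Qed.

Lemma quadric_resolution_minimal :
  minimal_graded_free_resolution G quadric_resolution.
Proof.
have fE i a b : gf_diff quadric_resolution i a b = f by rewrite mxE.
have rV0 j (v : 'rV[S]_j) : j = 0%N -> v = 0.
  by move=> j0; subst j; apply/rowP => -[].
split; last first.
  move=> i a b; rewrite fE; apply: (dhomog_nemf_coeff triangle_quadric_homog).
  by rewrite mf0.
split=> [i a b mm|].
  by rewrite fE => /(dhomog_mf triangle_quadric_homog) /= ->.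
exists (fun _ => 1).
have augE v : augmentation (F := quadric_resolution) (fun _ => 1 : OT G) v =
    ot_proj G (v 0 0).
  by rewrite /augmentation big_ord1 mulr1.
split.
- by move=> a; exists 1; [exact: dhomog1 | rewrite /ot_proj rmorph1].
- move=> x; exists (const_mx (repr x)).
  by rewrite augE mxE /ot_proj reprK.
- move=> v; rewrite augE ot_proj_eq0; split=> [[q e]|[w ->]].
    exists (const_mx q); apply/rowP => j.
    by rewrite ord1 !mxE big_ord1 !mxE.
  by exists (w 0 0); rewrite !mxE big_ord1 mxE.
- move=> [|i] v; last first.
    by rewrite (rV0 _ v) // mul0mx; split=> // _; exists 0; rewrite mul0mx.
  split=> [|[w ->]]; last by rewrite (rV0 _ w) // !mul0mx.
  move=> /rowP/(_ 0); rewrite !mxE big_ord1 mxE => /eqP.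
  rewrite mulf_eq0 (negbTE triangle_quadric_neq0) orbF => /eqP v0.
  by exists 0; apply/rowP => j; rewrite mul0mx ord1 v0 mxE.
Qed.

End Family.

(** * The two minimum distances *)

Lemma triangle_code_distance2 (K : fieldType) : linear_code (triangle_code K 0) 2.
Proof.
split=> //; first exact: triangle_code_rank.
split.
  exists (delta_mx 0 0 *m triangle_code K 0).
  have w2 : hamming_weight (delta_mx 0 0 *m triangle_code K 0) = 2%N.
    rewrite hamming_weight_codeword !big_ord_recl big_ord0 !mxE /=.
    by rewrite addr0 oner_neq0 eqxx.
  split=> //; first by exists (delta_mx 0 0).
  apply: contra_eq_neq w2 => ->.
  by rewrite /hamming_weight cardsE eq_card0 // => j; rewrite unfold_in mxE eqxx.
move=> _ [x ->]; apply: contra_neqT; rewrite -ltnNge hamming_weight_codeword.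
rewrite !big_ord_recl big_ord0 addn0 => hx.
suff -> : x = 0 by rewrite mul0mx.
(* If exactly one of x_0 and x_1 vanishes, then their sum does not. *)
apply/rowP => j; rewrite mxE; move: hx.
case: (eqVneq (x 0 ord0) 0) => [x0|x0];
  case: (eqVneq (x 0 (lift ord0 ord0)) 0) => [x1|x1] //=.
- by move=> _; case: (unliftP ord0 j) => [l ->|->] //; rewrite ord1.
- by rewrite x0 add0r x1.
- by rewrite x1 addr0 x0.
Qed.

Lemma triangle_code_distance1 (K : fieldType) : linear_code (triangle_code K 1) 1.
Proof.
split=> //; first exact: triangle_code_rank.
have wt0 : hamming_weight (0 : 'rV[K]_4) = 0%N.
  by rewrite /hamming_weight cardsE eq_card0 // => j; rewrite unfold_in mxE eqxx.
split.
  exists (delta_mx 0 ord_max *m triangle_code K 1).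
  have w1 : hamming_weight (delta_mx 0 ord_max *m triangle_code K 1) = 1%N.
    rewrite hamming_weight_codeword !big_ord_recl big_ord0 !mxE /=.
    by rewrite addr0 oner_neq0 eqxx.
  split=> //; first by exists (delta_mx 0 ord_max).
  by apply: contra_eq_neq w1 => ->; rewrite wt0.
move=> c _ c0; rewrite lt0n; apply: contra_neq c0 => /eqP.
rewrite cards_eq0 => /eqP/setP c0; apply/rowP => j; rewrite mxE.
by have := c0 j; rewrite !inE => /negbFE/eqP.
Qed.

Theorem proposition3p10 :
  exists (K : fieldType) (n1 k1 d1 n2 k2 d2 : nat)
         (G1 : 'M[K]_(k1, n1)) (G2 : 'M[K]_(k2, n2)),
    linear_code G1 d1 /\
    linear_code G2 d2 /\
    pairwise_nonproportional G1 /\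
    pairwise_nonproportional G2 /\
    same_graded_betti_numbers G1 G2 /\
    d1 <> d2.
Proof.
exists rat, 3, 2, 2, 4, 3, 1, (triangle_code rat 0), (triangle_code rat 1).
split; first exact: triangle_code_distance2.
split; first exact: triangle_code_distance1.
split; first exact: triangle_code_nonproportional.
split; first exact: triangle_code_nonproportional.
split=> //; exists (betti (quadric_resolution rat 0)).
by split; [exists (quadric_resolution rat 0) | exists (quadric_resolution rat 1)];
   rewrite //; apply: quadric_resolution_minimal.
Qed.
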